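(* Let $\alpha,\Gamma\in\mathbb{R}$. The Dullin–Gottwald–Holm equation $$m_t+um_x+2u_xm=\alpha u_x+\Gamma u_{xxx},\qquad m=u-u_{xx},\quad u=u(t,x),$$ describes pseudo-spherical surfaces, with associated triplet of one-forms $$\theta_1=(m+b)\,dx-\left[(u+\Gamma)m+(b+1)u+b(\Gamma+1)\mp\eta u_x\right]dt,$$ $$\theta_2=\eta\,dx-\left[\eta(1+u+\Gamma)\mp u_x\right]dt,$$ $$\theta_3=\pm(m+b+1)\,dx+\left[\eta u_x\mp(u+\Gamma)(m+1)\mp(u+1)(b+1)\mp\Gamma b\right]dt,$$ where $\eta,b$ are real constants with $\eta^2=2+2b+\alpha+\Gamma$, and where either all upper signs or all lower signs are taken. In particular, the Dullin–Gottwald–Holm equation is geometrically integrable.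
   Context: A differential equation for a real function $u=u(t,x)$ is said to describe pseudo-spherical surfaces, with associated triplet of one-forms $\omega_1,\omega_2,\omega_3$ (whose coefficients depend on $u$ and its derivatives), if it is equivalent to the structure equations $d\omega_1=\omega_3\wedge\omega_2$, $d\omega_2=\omega_1\wedge\omega_3$, $d\omega_3=\omega_1\wedge\omega_2$ of a two-dimensional Riemannian manifold with Gaussian curvature $-1$ and metric tensor $g=\omega_1^2+\omega_2^2$. A differential equation is geometrically integrable if it describes a non-trivial one-parameter family of pseudo-spherical surfaces (here the parameter is $\eta$, with $b$ determined by it). *)

(* Defs.v *)
From Stdlib Require Import Reals.
From Coquelicot Require Import Coquelicot.
Open Scope R_scope.

(** Functions [u : R -> R -> R] take their arguments in the order [u t x]. *)

(** A jet lists the values of the partial derivatives: [J i j] stands for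
    [d^(i+j) u / dt^i dx^j], so [J 0 0] is [u] and [J 0 1] is [u_x]. *)
Definition jet := nat -> nat -> R.

Definition jet_of (u : R -> R -> R) (t x : R) : jet :=
  fun i j => partial_derive i j u t x.

(** [coef_x dx + coef_t dt]. *)
Record oneform := OneForm { coef_x : jet -> R; coef_t : jet -> R }.

Record triplet := Triplet { form1 : oneform; form2 : oneform; form3 : oneform }.

(** Two-forms are represented by their coefficient on [dx /\ dt]; hence
    [d (f dx + g dt) = g_x - f_t], the derivatives being taken along [u]. *)
Definition ext_d (w : oneform) (u : R -> R -> R) (t x : R) : R :=
  Derive (fun z => coef_t w (jet_of u t z)) x
  - Derive (fun s => coef_x w (jet_of u s x)) t.

Definition wedge (w w' : oneform) (J : jet) : R :=
  coef_x w J * coef_t w' J - coef_t w J * coef_x w' J.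

Definition structure_equations (W : triplet) (u : R -> R -> R) (t x : R) : Prop :=
  ext_d (form1 W) u t x = wedge (form3 W) (form2 W) (jet_of u t x) /\
  ext_d (form2 W) u t x = wedge (form1 W) (form3 W) (jet_of u t x) /\
  ext_d (form3 W) u t x = wedge (form1 W) (form2 W) (jet_of u t x).

(** The metric [form1^2 + form2^2], as a quadratic form on the tangent vector
    [vx d/dx + vt d/dt]. *)
Definition apply_form (w : oneform) (J : jet) (vx vt : R) : R :=
  coef_x w J * vx + coef_t w J * vt.

Definition metric (W : triplet) (J : jet) (vx vt : R) : R :=
  (apply_form (form1 W) J vx vt) ^ 2 + (apply_form (form2 W) J vx vt) ^ 2.

Definition class_C (k : nat) (D : R * R -> Prop) (u : R -> R -> R) : Prop :=
  forall t x, D (t, x) -> ex_diff_n u k t x.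

Definition pde := (R -> R -> R) -> R -> R -> Prop.

Definition solution (k : nat) (E : pde) (D : R * R -> Prop) (u : R -> R -> R) : Prop :=
  class_C k D u /\ forall t x, D (t, x) -> E u t x.

(** A coefficient involves only derivatives of order less than [k], and
    depends on them regularly enough to be [C^1] along every [C^k] function:
    [Derive] in [ext_d] is then a genuine derivative. *)
Definition admissible_coef (k : nat) (f : jet -> R) : Prop :=
  (forall J J' : jet,
     (forall i j, (i + j < k)%nat -> J i j = J' i j) -> f J = f J') /\
  (forall (D : R * R -> Prop) (u : R -> R -> R), open D -> class_C k D u ->
     class_C 1 D (fun t x => f (jet_of u t x))).

Definition admissible_form (k : nat) (w : oneform) : Prop :=
  admissible_coef k (coef_x w) /\ admissible_coef k (coef_t w).

Definition admissible (k : nat) (W : triplet) : Prop :=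
  admissible_form k (form1 W) /\ admissible_form k (form2 W) /\
  admissible_form k (form3 W).

(** [form1^2 + form2^2] is positive definite exactly where
    [form1 /\ form2 <> 0]. *)
Definition nondegenerate_on (W : triplet) (D : R * R -> Prop) (u : R -> R -> R) : Prop :=
  forall t x, D (t, x) -> wedge (form1 W) (form2 W) (jet_of u t x) <> 0.

(** Degenerate solutions such as constants are unavoidable, so that
    nondegeneracy of the metric is only required for some solution; without
    this clause, triplets with [form1 /\ form2] identically zero, which define
    no surface at all, would be allowed. *)
Definition describes_pss (k : nat) (E : pde) (W : triplet) : Prop :=
  admissible k W /\
  (forall (D : R * R -> Prop) (u : R -> R -> R), open D -> class_C k D u ->
     ((forall t x, D (t, x) -> E u t x) <->
      (forall t x, D (t, x) -> structure_equations W u t x))) /\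
  (exists (D : R * R -> Prop) (u : R -> R -> R),
     open D /\ (exists p, D p) /\ solution k E D u /\ nondegenerate_on W D u).

Definition smooth_in_parameter (W : R -> triplet) : Prop :=
  forall (J : jet) (n : nat) (eta : R),
    ex_derive_n (fun e => coef_x (form1 (W e)) J) n eta /\
    ex_derive_n (fun e => coef_t (form1 (W e)) J) n eta /\
    ex_derive_n (fun e => coef_x (form2 (W e)) J) n eta /\
    ex_derive_n (fun e => coef_t (form2 (W e)) J) n eta /\
    ex_derive_n (fun e => coef_x (form3 (W e)) J) n eta /\
    ex_derive_n (fun e => coef_t (form3 (W e)) J) n eta.

(** Nontriviality concerns the metrics and not merely the one-forms: rotating
    the coframe [form1, form2] by a parameter-dependent angle would change the
    forms but not the surfaces. *)
Definition nontrivial_family (k : nat) (E : pde) (W : R -> triplet) : Prop :=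
  forall eta eta' : R, eta <> eta' ->
  exists (D : R * R -> Prop) (u : R -> R -> R),
    open D /\ solution k E D u /\
    nondegenerate_on (W eta) D u /\ nondegenerate_on (W eta') D u /\
    exists t x vx vt : R, D (t, x) /\
      metric (W eta) (jet_of u t x) vx vt <> metric (W eta') (jet_of u t x) vx vt.

Definition describes_nontrivial_pss_family (k : nat) (E : pde) (W : R -> triplet) : Prop :=
  smooth_in_parameter W /\ (forall eta, describes_pss k E (W eta)) /\
  nontrivial_family k E W.

Definition geometrically_integrable (k : nat) (E : pde) : Prop :=
  exists W : R -> triplet, describes_nontrivial_pss_family k E W.

Definition DGH (alpha Gamma : R) : pde := fun u t x =>
  let m := fun s z => u s z - partial_derive 0 2 u s z in
  partial_derive 1 0 m t x + u t x * partial_derive 0 1 m t x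
    + 2 * partial_derive 0 1 u t x * m t x
  = alpha * partial_derive 0 1 u t x + Gamma * partial_derive 0 3 u t x.

(** The upper signs correspond to [sg = 1], the lower ones to [sg = -1]. *)
Definition DGH_theta (Gamma sg eta b : R) : triplet :=
  let u := fun J : jet => J 0%nat 0%nat in
  let ux := fun J : jet => J 0%nat 1%nat in
  let m := fun J : jet => J 0%nat 0%nat - J 0%nat 2%nat in
  Triplet
    (OneForm (fun J => m J + b)
       (fun J => - ((u J + Gamma) * m J + (b + 1) * u J + b * (Gamma + 1)
                    - sg * eta * ux J)))
    (OneForm (fun J => eta)
       (fun J => - (eta * (1 + u J + Gamma) - sg * ux J)))
    (OneForm (fun J => sg * (m J + b + 1))
       (fun J => eta * ux J - sg * (u J + Gamma) * (m J + 1)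
                 - sg * (u J + 1) * (b + 1) - sg * Gamma * b)).

(* Main.v *)
Require Import Defs.
From Stdlib Require Import Reals.
From Coquelicot Require Import Coquelicot.
From Stdlib Require Import Lra Lia.
Open Scope R_scope.

(** With [q = u], [p = u_x], [r = u_xx], [w = u_xxx] and [m = q - r], put
<<
  F = m_t + (q + Gamma) (p - w) + 2 p m + (2 + 2 b - eta^2) p.
>>
    When [sg^2 = 1], expanding the three structure equations gives
<<
  d theta1 - theta3 /\ theta2 = - F,
  d theta2 - theta1 /\ theta3 = 0,
  d theta3 - theta1 /\ theta2 = - sg F.
>>
    The relation [eta^2 = 2 + 2 b + alpha + Gamma] turns [F = 0] into the
    Dullin-Gottwald-Holm equation.  The equivalence is thus pointwise, and only
    needs the derivatives up to order three to exist at the point considered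
    ([DGH_iff_structure_equations]).

    A surface must also exist.  If [m] is the constant [K = (alpha + Gamma) / 2]
    then [m_t = m_x = 0] and [u_xxx = u_x], and the equation reduces to
    [2 u_x K = (alpha + Gamma) u_x], which holds.  So [u = K + exp x] is a
    solution on the whole plane, whatever [alpha] and [Gamma], and along it
<<
  theta1 /\ theta2 = - sg exp x ((eta - sg)^2 + 1) / 2  dx /\ dt,
>>
    which vanishes nowhere ([exp_solution_nondegenerate]).

    The same solution tells the members of the family apart
    ([DGH_theta_nontrivial]).  There [m + b = eta^2 / 2 - 1], so the [dx^2]
    coefficient of the metric is [(m + b)^2 + eta^2 = eta^4 / 4 + 1], which
    determines [eta] up to sign; and the part of the [dx dt] coefficient that is
    odd in [eta] is [sg eta^3 u_x], which separates [eta] from [- eta] when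
    [eta <> 0].

    Finally, the coefficients are polynomials in [u], [u_x] and [u_xx], whence
    their regularity along a [C^k] function ([DGH_theta_admissible]), and
    quadratic polynomials in [eta], whence smoothness in the parameter
    ([DGH_theta_smooth_in_parameter]). *)

(** * Functions of class C^n on an open set *)

Lemma open_locally_2d (D : R * R -> Prop) (P : R -> R -> Prop) (t x : R) :
  open D -> D (t, x) -> (forall s z, D (s, z) -> P s z) -> locally_2d P t x.
Proof.
  intros HD Dtx HP; apply locally_2d_locally.
  apply filter_imp with (2 := HD _ Dtx); intros [s z] Hsz; exact (HP s z Hsz).
Qed.

Lemma class_C_le (k n : nat) (D : R * R -> Prop) (f : R -> R -> R) :
  (n <= k)%nat -> class_C k D f -> class_C n D f.
Proof. intros Hn Hf t x Dtx; apply ex_diff_n_m with (1 := Hn); auto. Qed.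

Lemma class_C_ext (n : nat) (D : R * R -> Prop) (f g : R -> R -> R) :
  open D -> (forall t x, D (t, x) -> f t x = g t x) ->
  class_C n D f -> class_C n D g.
Proof.
  intros HD Hfg Hf t x Dtx; apply ex_diff_n_ext_loc with f; [|now apply Hf].
  now apply open_locally_2d with D.
Qed.

(** On an open set the partial derivatives may be replaced by any functions
    agreeing with them there; the inductions on [n] below then only need to
    exhibit those functions. *)
Lemma class_C_S (n : nat) (D : R * R -> Prop) (f : R -> R -> R) :
  open D ->
  class_C (S n) D f <->
  class_C 0 D f /\
  exists ft fx : R -> R -> R,
    (forall t x, D (t, x) ->
       is_derive (fun s => f s x) t (ft t x) /\ is_derive (f t) x (fx t x)) /\
    class_C n D ft /\ class_C n D fx.
Proof.
  intros HD; split.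
  - intros Hf; split; [now apply class_C_le with (S n); [lia|]|].
    exists (fun t x => Derive (fun s => f s x) t), (fun t x => Derive (f t) x).
    repeat split; try (intros t x Dtx; apply (Hf t x Dtx));
      apply Derive_correct, (Hf t x); assumption.
  - intros [Hc [ft [fx [Hd [Ht Hx]]]]] t x Dtx.
    split; [apply (Hc t x Dtx)|].
    split; [exists (ft t x); now apply Hd|].
    split; [exists (fx t x); now apply Hd|].
    split.
    + refine (class_C_ext n D ft _ HD _ Ht t x Dtx).
      intros s z Dsz; symmetry; now apply is_derive_unique, Hd.
    + refine (class_C_ext n D fx _ HD _ Hx t x Dtx).
      intros s z Dsz; symmetry; now apply is_derive_unique, Hd.
Qed.

Lemma class_C_const (n : nat) (D : R * R -> Prop) (c : R) :
  open D -> class_C n D (fun _ _ => c).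
Proof.
  intros HD; revert c; induction n as [|n IH]; intros c.
  { intros t x _; split; [apply continuity_2d_pt_const | exact I]. }
  apply class_C_S; [exact HD|].
  split; [intros t x _; split; [apply continuity_2d_pt_const | exact I]|].
  exists (fun _ _ => 0), (fun _ _ => 0); split; [|split; apply IH].
  intros t x _; split; apply @is_derive_const.
Qed.

Lemma class_C_plus (n : nat) (D : R * R -> Prop) (f g : R -> R -> R) :
  open D -> class_C n D f -> class_C n D g ->
  class_C n D (fun t x => f t x + g t x).
Proof.
  intros HD; revert f g.
  assert (H0 : forall f g, class_C 0 D f -> class_C 0 D g ->
            class_C 0 D (fun t x => f t x + g t x)).
  { intros f g Hf Hg t x Dtx; split; [|exact I].
    apply continuity_2d_pt_plus; [apply (Hf t x Dtx) | apply (Hg t x Dtx)]. }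
  induction n as [|n IH]; intros f g Hf Hg; [now apply H0|].
  apply class_C_S in Hf as [Hf [ft [fx [Df [Hft Hfx]]]]]; [|exact HD].
  apply class_C_S in Hg as [Hg [gt [gx [Dg [Hgt Hgx]]]]]; [|exact HD].
  apply class_C_S; [exact HD|]; split; [now apply H0|].
  exists (fun t x => ft t x + gt t x), (fun t x => fx t x + gx t x).
  split; [|split; now apply IH].
  intros t x Dtx; destruct (Df t x Dtx), (Dg t x Dtx).
  split; now apply @is_derive_plus.
Qed.

Lemma class_C_mult (n : nat) (D : R * R -> Prop) (f g : R -> R -> R) :
  open D -> class_C n D f -> class_C n D g ->
  class_C n D (fun t x => f t x * g t x).
Proof.
  intros HD; revert f g.
  assert (H0 : forall f g, class_C 0 D f -> class_C 0 D g ->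
            class_C 0 D (fun t x => f t x * g t x)).
  { intros f g Hf Hg t x Dtx; split; [|exact I].
    apply continuity_2d_pt_mult; [apply (Hf t x Dtx) | apply (Hg t x Dtx)]. }
  induction n as [|n IH]; intros f g Hf Hg; [now apply H0|].
  assert (Hf' := class_C_le _ n _ _ (Nat.le_succ_diag_r n) Hf).
  assert (Hg' := class_C_le _ n _ _ (Nat.le_succ_diag_r n) Hg).
  apply class_C_S in Hf as [Hf [ft [fx [Df [Hft Hfx]]]]]; [|exact HD].
  apply class_C_S in Hg as [Hg [gt [gx [Dg [Hgt Hgx]]]]]; [|exact HD].
  apply class_C_S; [exact HD|]; split; [now apply H0|].
  exists (fun t x => ft t x * g t x + f t x * gt t x),
         (fun t x => fx t x * g t x + f t x * gx t x).
  split; [|split; apply class_C_plus; trivial; now apply IH].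
  intros t x Dtx; destruct (Df t x Dtx), (Dg t x Dtx).
  split.
  - apply (is_derive_mult (fun s => f s x) (fun s => g s x)); trivial.
    apply Rmult_comm.
  - apply (is_derive_mult (f t) (g t)); trivial; apply Rmult_comm.
Qed.

Lemma class_C_opp (n : nat) (D : R * R -> Prop) (f : R -> R -> R) :
  open D -> class_C n D f -> class_C n D (fun t x => - f t x).
Proof.
  intros HD Hf; apply class_C_ext with (fun t x => -1 * f t x); trivial.
  { intros; ring. }
  apply (class_C_mult n D (fun _ _ => -1)); trivial; now apply class_C_const.
Qed.

Lemma class_C_partial_derive (k n p q : nat) (D : R * R -> Prop) (u : R -> R -> R) :
  (p + q + n <= k)%nat -> class_C k D u -> class_C n D (partial_derive p q u).
Proof.
  intros Hk Hu t x Dtx; apply ex_diff_n_m with (k - (p + q))%nat; [lia|].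
  apply ex_diff_n_deriv; [lia | now apply Hu].
Qed.

(** * The one-forms of the Dullin-Gottwald-Holm equation *)

(** Three orders of differentiability are what [u_xx], the highest derivative
    in the coefficients, needs in order to be [C^1]. *)
Lemma DGH_theta_admissible (k : nat) (Gamma sg eta b : R) :
  (3 <= k)%nat -> admissible k (DGH_theta Gamma sg eta b).
Proof.
  intros hk.
  split; [|split]; split; split.
  1, 3, 5, 7, 9, 11 : intros J J' HJ; cbn;
    rewrite ?(HJ 0%nat 0%nat), ?(HJ 0%nat 1%nat), ?(HJ 0%nat 2%nat) by lia;
    reflexivity.
  all: intros D u HD Hu; cbn [coef_x coef_t Defs.form1 Defs.form2 Defs.form3 DGH_theta];
    unfold jet_of, Rminus.
  all: repeat first
    [ apply class_C_const; exact HD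
    | apply class_C_partial_derive with k; [lia | exact Hu]
    | apply class_C_plus; [exact HD | |]
    | apply class_C_mult; [exact HD | |]
    | apply class_C_opp; [exact HD |] ].
Qed.

(** The constraint makes [b] a quadratic polynomial in [eta], and no coefficient
    contains a product of [b] and [eta]. *)
Lemma DGH_theta_smooth_in_parameter (alpha Gamma sg : R) (b : R -> R) :
  (forall eta, eta ^ 2 = 2 + 2 * b eta + alpha + Gamma) ->
  smooth_in_parameter (fun eta => DGH_theta Gamma sg eta (b eta)).
Proof.
  intros Hb.
  assert (Hquad : forall (f : R -> R) (c0 c1 c2 : R),
    (forall e, f e = c0 + c1 * e + c2 * e ^ 2) ->
    forall n e, ex_derive_n f n e).
  { intros f c0 c1 c2 Hf.
    assert (Hn : forall n, exists d0 d1 d2,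
      forall e, Derive_n f n e = d0 + d1 * e + d2 * e ^ 2).
    { induction n as [|n [d0 [d1 [d2 Hd]]]]; [now exists c0, c1, c2|].
      exists d1, (2 * d2), 0; intros e; simpl.
      rewrite (Derive_ext _ _ _ Hd); apply is_derive_unique.
      auto_derive; [trivial | ring]. }
    intros [|n] e; [exact I|]; destruct (Hn n) as [d0 [d1 [d2 Hd]]].
    apply ex_derive_ext with (fun e => d0 + d1 * e + d2 * e ^ 2).
    { intros; now rewrite Hd. }
    auto_derive; trivial. }
  assert (Hb' : forall e, b e = (e ^ 2 - (2 + alpha + Gamma)) / 2).
  { intros e; rewrite Hb; field. }
  assert (Hquad' : forall (f : R -> R) (c0 c1 c2 : R),
    (forall e, f e = c0 + c1 * e + c2 * b e) ->
    forall n e, ex_derive_n f n e).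
  { intros f c0 c1 c2 Hf.
    apply (Hquad f (c0 - c2 * (2 + alpha + Gamma) / 2) c1 (c2 / 2)).
    intros e; rewrite Hf, Hb'; field. }
  intros J n eta; cbn.
  set (q := J 0%nat 0%nat); set (p := J 0%nat 1%nat); set (r := J 0%nat 2%nat).
  repeat split.
  - apply (Hquad' _ (q - r) 0 1); intros; ring.
  - apply (Hquad' _ (- ((q + Gamma) * (q - r) + q)) (sg * p) (- (q + (Gamma + 1))));
      intros; ring.
  - apply (Hquad' _ 0 1 0); intros; ring.
  - apply (Hquad' _ (sg * p) (- (1 + q + Gamma)) 0); intros; ring.
  - apply (Hquad' _ (sg * (q - r + 1)) 0 sg); intros; ring.
  - apply (Hquad' _ (- sg * (q + Gamma) * (q - r + 1) - sg * (q + 1)) p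
             (- sg * (q + 1) - sg * Gamma)); intros; ring.
Qed.

(** Mixed derivatives enter only through [m_t = u_t - u_xxt], which both sides
    compute by differentiating in [x] first, so that no exchange of derivatives
    is involved. *)
Lemma DGH_iff_structure_equations (alpha Gamma sg eta b : R) (u : R -> R -> R) (t x : R) :
  sg = 1 \/ sg = -1 -> eta ^ 2 = 2 + 2 * b + alpha + Gamma ->
  ex_diff_n u 3 t x ->
  DGH alpha Gamma u t x <-> structure_equations (DGH_theta Gamma sg eta b) u t x.
Proof.
  intros Hsg Heta Hu.
  assert (Hx : forall j, (j < 3)%nat ->
    is_derive (partial_derive 0 j u t) x (partial_derive 0 (S j) u t x)).
  { intros j Hj; apply Derive_correct.
    now apply (ex_diff_n_ex_deriv_inf_2 3 0 j). }
  assert (Ht : forall j, (j < 3)%nat ->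
    is_derive (fun s => partial_derive 0 j u s x) t (partial_derive 1 j u t x)).
  { intros j Hj; apply Derive_correct.
    now apply (ex_diff_n_ex_deriv_inf_1 3 0 j). }
  assert (H0 := Hx 0%nat ltac:(lia)); assert (H1 := Hx 1%nat ltac:(lia)).
  assert (H2 := Hx 2%nat ltac:(lia)).
  assert (K0 := Ht 0%nat ltac:(lia)); assert (K2 := Ht 2%nat ltac:(lia)).
  unfold DGH, structure_equations, ext_d, wedge.
  cbn [coef_x coef_t Defs.form1 Defs.form2 Defs.form3 DGH_theta]; unfold jet_of.
  set (m := fun s z => u s z - partial_derive 0 2 u s z).
  assert (Em : partial_derive 1 0 m t x
               = partial_derive 1 0 u t x - partial_derive 1 2 u t x).
  { now apply is_derive_unique, @is_derive_minus. }
  assert (Em' : partial_derive 0 1 m t x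
                = partial_derive 0 1 u t x - partial_derive 0 3 u t x).
  { now apply is_derive_unique, @is_derive_minus. }
  rewrite Em, Em'; unfold m; clear Hx Ht Em Em' m.
  change (u t x) with (partial_derive 0 0 u t x).
  set (u_t := partial_derive 1 0 u t x) in *.
  set (uxx_t := partial_derive 1 2 u t x) in *.
  rewrite Derive_const.
  set (q := partial_derive 0 0 u) in *; set (p := partial_derive 0 1 u) in *.
  set (r := partial_derive 0 2 u) in *; set (w := partial_derive 0 3 u) in *.
  assert (L0 : Derive (fun z => q t z) x = p t x) by exact (is_derive_unique _ _ _ H0).
  assert (L1 : Derive (fun z => p t z) x = r t x) by exact (is_derive_unique _ _ _ H1).
  assert (L2 : Derive (fun z => r t z) x = w t x) by exact (is_derive_unique _ _ _ H2).
  assert (M0 : Derive (fun s => q s x) t = u_t) by exact (is_derive_unique _ _ _ K0).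
  assert (M2 : Derive (fun s => r s x) t = uxx_t) by exact (is_derive_unique _ _ _ K2).
  assert (D1 : Derive (fun z => - ((q t z + Gamma) * (q t z - r t z)
      + (b + 1) * q t z + b * (Gamma + 1) - sg * eta * p t z)) x
    = - (p t x * (q t x - r t x) + (q t x + Gamma) * (p t x - w t x)
         + (b + 1) * p t x - sg * eta * r t x)).
  { apply is_derive_unique; auto_derive;
      [ repeat split; eexists; eassumption
      | rewrite L0, L1, L2; ring ]. }
  assert (D2 : Derive (fun z => - (eta * (1 + q t z + Gamma) - sg * p t z)) x
    = - (eta * p t x - sg * r t x)).
  { apply is_derive_unique; auto_derive;
      [ repeat split; eexists; eassumption
      | rewrite L0, L1; ring ]. }
  assert (D3 : Derive (fun z => eta * p t z - sg * (q t z + Gamma) * (q t z - r t z + 1)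
      - sg * (q t z + 1) * (b + 1) - sg * Gamma * b) x
    = eta * r t x - sg * (p t x * (q t x - r t x + 1)
        + (q t x + Gamma) * (p t x - w t x)) - sg * p t x * (b + 1)).
  { apply is_derive_unique; auto_derive;
      [ repeat split; eexists; eassumption
      | rewrite L0, L1, L2; ring ]. }
  assert (E1 : Derive (fun s => q s x - r s x + b) t = u_t - uxx_t).
  { apply is_derive_unique; auto_derive;
      [ repeat split; eexists; eassumption
      | rewrite M0, M2; ring ]. }
  assert (E3 : Derive (fun s => sg * (q s x - r s x + b + 1)) t = sg * (u_t - uxx_t)).
  { apply is_derive_unique; auto_derive;
      [ repeat split; eexists; eassumption
      | rewrite M0, M2; ring ]. }
  rewrite D1, D2, D3, E1, E3; clear - Hsg Heta.
  (* Once [alpha] is eliminated and the sign fixed, both directions are linear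
     in the monomials; for the converse the first equation is enough. *)
  replace alpha with (eta ^ 2 - 2 - 2 * b - Gamma) by lra.
  destruct Hsg as [-> | ->]; (split; [intros HE; repeat split; lra|]);
    intros [HS _]; lra.
Qed.

(** * A nondegenerate solution *)

(** The additive constant is the value of [u - u_xx] for which the equation
    holds identically in [u_x]. *)
Definition exp_solution (alpha Gamma : R) : R -> R -> R :=
  fun t x => (alpha + Gamma) / 2 + exp x.

Lemma class_C_exp (n : nat) (D : R * R -> Prop) :
  open D -> class_C n D (fun t x => exp x).
Proof.
  intros HD.
  assert (H0 : class_C 0 D (fun t x => exp x)).
  { intros t x _; split; [|exact I].
    apply (continuity_1d_2d_pt_comp exp (fun _ z => z));
      [apply derivable_continuous, derivable_exp | apply continuity_2d_pt_id2]. }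
  induction n as [|n IH]; [exact H0|].
  apply class_C_S; [exact HD|]; split; [exact H0|].
  exists (fun _ _ => 0), (fun _ x => exp x).
  split; [|split; [now apply class_C_const | exact IH]].
  intros t x _; split; [apply @is_derive_const | apply is_derive_exp].
Qed.

Lemma exp_solution_dx (alpha Gamma t x : R) (j : nat) :
  partial_derive 0 (S j) (exp_solution alpha Gamma) t x = exp x.
Proof.
  unfold partial_derive, exp_solution; simpl; revert x.
  induction j as [|j IH]; intros x; simpl.
  - apply is_derive_unique; auto_derive; [trivial | ring].
  - rewrite (Derive_ext _ exp) by apply IH.
    apply is_derive_unique, is_derive_exp.
Qed.

Lemma exp_solution_DGH (alpha Gamma t x : R) :
  DGH alpha Gamma (exp_solution alpha Gamma) t x.
Proof.
  unfold DGH; cbv zeta; rewrite !exp_solution_dx.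
  replace (partial_derive 1 0 _ t x) with 0.
  2: { unfold partial_derive, exp_solution; simpl; symmetry; apply Derive_const. }
  replace (partial_derive 0 1 _ t x) with 0.
  2: { symmetry; unfold partial_derive at 1; simpl.
    rewrite (Derive_ext _ (fun _ => (alpha + Gamma) / 2)); [apply Derive_const|].
    intros z; rewrite exp_solution_dx; unfold exp_solution; ring. }
  unfold exp_solution; field.
Qed.

Lemma exp_solution_solution (alpha Gamma : R) (k : nat) :
  solution k (DGH alpha Gamma) (fun _ => True) (exp_solution alpha Gamma).
Proof.
  split; [|intros; apply exp_solution_DGH].
  apply class_C_plus; [apply open_true | apply class_C_const, open_true |
    apply class_C_exp, open_true].
Qed.

(** Along this solution [m + b = eta^2 / 2 - 1], so [theta1 /\ theta2] is a
    multiple of [eta^2 - 2 sg eta + 2], a quadratic without real roots. *)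
Lemma exp_solution_nondegenerate (alpha Gamma sg eta b : R) :
  sg = 1 \/ sg = -1 -> eta ^ 2 = 2 + 2 * b + alpha + Gamma ->
  nondegenerate_on (DGH_theta Gamma sg eta b) (fun _ => True)
    (exp_solution alpha Gamma).
Proof.
  intros Hsg Heta t x _.
  unfold wedge; cbn [coef_x coef_t Defs.form1 Defs.form2 DGH_theta]; unfold jet_of.
  rewrite !exp_solution_dx.
  change (partial_derive 0 0 (exp_solution alpha Gamma) t x)
    with ((alpha + Gamma) / 2 + exp x).
  assert (He := exp_pos x); set (y := exp x) in *.
  replace alpha with (eta ^ 2 - 2 - 2 * b - Gamma) by lra.
  match goal with |- ?W <> 0 =>
    assert (EW : W = - sg * y * ((eta - sg) ^ 2 + 1) / 2)
      by (destruct Hsg as [-> | ->]; field) end.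
  assert (Hsq := pow2_ge_0 (eta - sg)).
  assert (0 < y * ((eta - sg) ^ 2 + 1)) by (apply Rmult_lt_0_compat; lra).
  rewrite EW; destruct Hsg as [-> | ->]; lra.
Qed.

(** * Pseudo-spherical surfaces and nontriviality of the family *)

Lemma DGH_theta_describes_pss (alpha Gamma sg eta b : R) (k : nat) :
  (3 <= k)%nat -> sg = 1 \/ sg = -1 ->
  eta ^ 2 = 2 + 2 * b + alpha + Gamma ->
  describes_pss k (DGH alpha Gamma) (DGH_theta Gamma sg eta b).
Proof.
  intros hk Hsg Heta; split; [now apply DGH_theta_admissible|]; split.
  - intros D u HD Hu.
    assert (H : forall t x, D (t, x) ->
      DGH alpha Gamma u t x <-> structure_equations (DGH_theta Gamma sg eta b) u t x).
    { intros t x Dtx; apply DGH_iff_structure_equations; trivial.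
      now apply (class_C_le k 3 D). }
    split; intros HE t x Dtx; apply H; auto.
  - exists (fun _ => True), (exp_solution alpha Gamma).
    split; [apply open_true|]; split; [now exists (0, 0)|].
    split; [apply exp_solution_solution | now apply exp_solution_nondegenerate].
Qed.

(** The metrics are compared at the origin on the tangent vectors [(1, 0)],
    [(1, 1)] and [(1, -1)]: the first gives the [dx^2] coefficient, and the
    difference of the other two isolates the [dx dt] coefficient. *)
Lemma DGH_theta_nontrivial (alpha Gamma sg : R) (b : R -> R) (k : nat) :
  sg = 1 \/ sg = -1 ->
  (forall eta, eta ^ 2 = 2 + 2 * b eta + alpha + Gamma) ->
  nontrivial_family k (DGH alpha Gamma)
    (fun eta => DGH_theta Gamma sg eta (b eta)).
Proof.
  intros Hsg Hb eta eta' Hne.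
  exists (fun _ => True), (exp_solution alpha Gamma).
  split; [apply open_true|]; split; [apply exp_solution_solution|].
  split; [now apply exp_solution_nondegenerate|].
  split; [now apply exp_solution_nondegenerate|].
  exists 0, 0.
  set (J := jet_of (exp_solution alpha Gamma) 0 0).
  assert (J0 : J 0%nat 0%nat = (alpha + Gamma) / 2 + 1).
  { unfold J, jet_of, partial_derive, exp_solution; simpl; now rewrite exp_0. }
  assert (J1 : forall j, J 0%nat (S j) = 1).
  { intros j; unfold J, jet_of; now rewrite exp_solution_dx, exp_0. }
  assert (Hb' : forall e, b e = (e ^ 2 - (2 + alpha + Gamma)) / 2).
  { intros e; rewrite Hb; field. }
  set (M := fun e vx vt => metric (DGH_theta Gamma sg e (b e)) J vx vt).
  assert (Mx : forall e, M e 1 0 = (e ^ 2) ^ 2 / 4 + 1).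
  { intros e; unfold M, metric, apply_form; cbn [coef_x coef_t Defs.form1 Defs.form2 DGH_theta].
    rewrite J0, !J1, Hb'; field. }
  assert (Mxt : forall e, M e 1 1 - M e 1 (-1) - (M (- e) 1 1 - M (- e) 1 (-1))
                          = 4 * sg * e ^ 3).
  { intros e; unfold M, metric, apply_form; cbn [coef_x coef_t Defs.form1 Defs.form2 DGH_theta].
    rewrite J0, !J1, !Hb'; field. }
  destruct (Req_dec (M eta 1 0) (M eta' 1 0)) as [E0 | N0]; [|now exists 1, 0].
  destruct (Req_dec (M eta 1 1) (M eta' 1 1)) as [E1 | N1]; [|now exists 1, 1].
  exists 1, (-1); split; [trivial|]; intros E2.
  change (M eta 1 (-1) = M eta' 1 (-1)) in E2.
  (* Equal [dx^2] coefficients leave only [eta' = - eta]. *)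
  assert (Hsq : (eta - eta') * (eta + eta') = 0).
  { rewrite !Mx in E0; nra. }
  apply Rmult_integral in Hsq as [? | Hopp]; [lra|].
  replace eta' with (- eta) in E1, E2 by lra.
  assert (H3 := Mxt eta); rewrite E1, E2 in H3.
  assert (H : eta ^ 3 <> 0) by (apply pow_nonzero; lra).
  destruct Hsg as [-> | ->]; lra.
Qed.

Theorem theorem1p4 (alpha Gamma : R) (k : nat) (hk : (3 <= k)%nat) :
  (forall sg eta b : R, sg = 1 \/ sg = -1 ->
     eta ^ 2 = 2 + 2 * b + alpha + Gamma ->
     describes_pss k (DGH alpha Gamma) (DGH_theta Gamma sg eta b)) /\
  (forall (sg : R) (b : R -> R), sg = 1 \/ sg = -1 ->
     (forall eta : R, eta ^ 2 = 2 + 2 * b eta + alpha + Gamma) ->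
     describes_nontrivial_pss_family k (DGH alpha Gamma)
       (fun eta => DGH_theta Gamma sg eta (b eta))) /\
  geometrically_integrable k (DGH alpha Gamma).
Proof.
  assert (Hfam : forall (sg : R) (b : R -> R), sg = 1 \/ sg = -1 ->
     (forall eta : R, eta ^ 2 = 2 + 2 * b eta + alpha + Gamma) ->
     describes_nontrivial_pss_family k (DGH alpha Gamma)
       (fun eta => DGH_theta Gamma sg eta (b eta))).
  { intros sg b Hsg Hb; split; [now apply DGH_theta_smooth_in_parameter with alpha|].
    split; [intros eta; now apply DGH_theta_describes_pss|].
    now apply DGH_theta_nontrivial. }
  split; [intros; now apply DGH_theta_describes_pss|].
  split; [exact Hfam|].
  exists (fun eta => DGH_theta Gamma 1 eta ((eta ^ 2 - (2 + alpha + Gamma)) / 2)).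
  apply (Hfam 1 (fun eta => (eta ^ 2 - (2 + alpha + Gamma)) / 2));
    [now left | intros; field].
Qed.
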